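(* For all $\delta \geq 0$ there exists $\Delta_\delta \geq 0$ such that the following holds. Let $\Gamma$ be a connected $\delta$-hyperbolic graph and let $H\subseteq \Gamma$ be a finite connected subgraph with $|V(H)|=n\ge 2$. Then there is a finite connected subgraph $F\subseteq \Gamma$ such that: 1. $H\subseteq F$; 2. $|V(F)|\le (16\delta+3)n^6$; 3. $F$ is $\Delta_\delta$-hyperbolic.
   Context: All graphs are simple, undirected and unweighted, and may be infinite unless stated to be finite. The vertex set $V(\Gamma)$ of a graph $\Gamma$ is equipped with its path metric $\mathrm{d}$; in particular a subgraph $F$, considered as a graph in its own right, carries its own path metric. Hyperbolicity: a graph $\Gamma$ is $\delta$-hyperbolic ($\delta\ge 0$) if for all $w,x,y,z\in V(\Gamma)$, $$\mathrm{d}(x,z)+\mathrm{d}(y,w)\le \max\{\mathrm{d}(x,y)+\mathrm{d}(z,w),\ \mathrm{d}(x,w)+\mathrm{d}(z,y)\}+2\delta ,$$ where $\mathrm{d}$ is the path metric of that graph. *)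

(* Defs.v *)
From mathcomp Require Import all_boot all_order all_algebra.
From mathcomp Require Import all_classical all_reals.
Set Implicit Arguments.
Unset Strict Implicit.
Unset Printing Implicit Defensive.
Import Order.TTheory GRing.Theory Num.Theory.

Local Open Scope classical_set_scope.

(** A graph and all of its subgraphs live over one ambient type [V], and each
    graph carries its own vertex set, so that the path metric of a subgraph is
    the one of the subgraph itself.  [V] and [verts] may be infinite. *)
Record sgraph (V : Type) := SGraph {
  verts : set V;
  edge : rel V;
  edge_sym : forall x y, edge x y -> edge y x;
  edge_irrefl : forall x, ~~ edge x x;
  edge_verts : forall x y, edge x y -> verts x /\ verts y
}.

Definition subgraph (V : Type) (H G : sgraph V) : Prop :=
  verts H `<=` verts G /\ forall x y, edge H x y -> edge G x y.

(** The vertices of the walk are [x :: p]; its length is [size p = k]. *)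
Definition walk (V : Type) (G : sgraph V) (x y : V) (k : nat) : Prop :=
  exists p : seq V, [/\ path (edge G) x p, last x p = y & size p = k].

Definition graph_connected (V : Type) (G : sgraph V) : Prop :=
  forall x y, verts G x -> verts G y -> exists k, walk G x y k.

(** The junk value [0] for unreachable pairs never occurs between vertices of
    a connected graph. *)
Definition gdist (V : Type) (G : sgraph V) (x y : V) : nat :=
  if pselect (exists k, `[< walk G x y k >]) is left w then ex_minn w else 0.

Lemma gdistP (V : Type) (G : sgraph V) (x y : V) :
  (exists k, walk G x y k) ->
  walk G x y (gdist G x y) /\ forall k, walk G x y k -> gdist G x y <= k.
Proof.
move=> [k wk]; rewrite /gdist; case: pselect => [w|]; last first.
  by case; exists k; apply/asboolP.
case: ex_minnP => m /asboolP wm mmin; split=> // j wj.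
by apply: mmin; apply/asboolP.
Qed.

Local Open Scope ring_scope.

(** Meant for connected graphs. *)
Definition hyperbolic (R : realType) (V : Type) (delta : R) (G : sgraph V)
    : Prop :=
  forall w x y z, verts G w -> verts G x -> verts G y -> verts G z ->
    let d u v : R := (gdist G u v)%:R in
    d x z + d y w <= Num.max (d x y + d z w) (d x w + d z y) + 2 * delta.

(* Main.v *)
Require Import Defs.
From mathcomp Require Import all_boot all_order all_algebra finmap.
From mathcomp Require Import all_classical all_reals.
From mathcomp Require Import lra zify.
Set Implicit Arguments.
Unset Strict Implicit.
Unset Printing Implicit Defensive.
Import Order.TTheory GRing.Theory Num.Theory.
Local Open Scope classical_set_scope.
Local Open Scope card_scope.
Local Open Scope ring_scope.

(** Let [X] be the union of one geodesic of [G] between each pair of vertices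
    of [H], and let [F] be the subgraph of [G] induced on the union [L] of one
    geodesic between each pair of vertices of [X] at distance at most
    [8 * delta].  Then the path metrics of [F] and [G] differ on [L] by at most
    the additive constant [64 * delta] ([linked_hull_walk]).  Such an error
    passes directly into the four-point inequality ([hyperbolic_additive]), so
    [F] is [65 * delta]-hyperbolic.

    The heart of the matter is that two points [x], [y] of [X], lying on
    geodesics [[a, b]] and [[c, e]] with ends in [H], are joined in [F] almost
    as efficiently as in [G].  In a tree the segment from [x] to [y] can be
    prolonged along [[a, b]] to one of the ends [a], [b], and along [[c, e]]
    to one of the ends [c], [e]; so [x] and [y] lie on a segment [[u, v]] with
    [u] in [{a, b}] and [v] in [{c, e}].  In [G] the same holds up to
    [6 * delta], unless [x] and [y] are within [3 * delta] of each other
    ([geod_pair]).  In the aligned case [x] and [y] are within [8 * delta] of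
    points [x'], [y'] of the chosen geodesic [[u, v]], which is part of [X]
    ([geod_near]).  The route from [x] to [x'], along [[u, v]] to [y'], and
    then to [y] stays in [L] and exceeds the distance by at most
    [32 * delta] ([hull_walk]).  Every vertex of [L] is joined to [X] by a
    walk of length at most [8 * delta], which accounts for the rest.

    As to the size, a connected graph with [n] vertices has diameter less than
    [n], so the geodesics that form [X] have at most [n] vertices each and [X]
    has at most [n ^ 3]; then [L] has at most [(8 * delta + 1) * n ^ 6]. *)

(** * Walks and the path metric *)

Lemma walk_refl (V : Type) (G : sgraph V) (x : V) : walk G x x 0.
Proof. by exists [::]. Qed.

Lemma walk_cat (V : Type) (G : sgraph V) (x y z : V) (j k : nat) :
  walk G x y j -> walk G y z k -> walk G x z (j + k).
Proof.
move=> [p [Gp <- <-]] [q [Gq <- <-]]; exists (p ++ q).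
by rewrite cat_path Gp Gq last_cat size_cat.
Qed.

Lemma walk_sym (V : Type) (G : sgraph V) (x y : V) (k : nat) :
  walk G x y k -> walk G y x k.
Proof.
move=> [p [Gp <- <-]]; exists (rev (belast x p)); split.
- rewrite rev_path (@eq_path _ _ (edge G)) // => u v /=.
  by apply/idP/idP; apply: edge_sym.
- by case: p Gp => //= y' p _; rewrite rev_cons last_rcons.
- by rewrite size_rev size_belast.
Qed.

Lemma walk_subgraph (V : Type) (F G : sgraph V) (x y : V) (k : nat) :
  subgraph F G -> walk F x y k -> walk G x y k.
Proof.
by move=> [_ FG] [p [Fp <- <-]]; exists p; split=> //; apply: sub_path Fp.
Qed.

Lemma path_verts (V : eqType) (G : sgraph V) (x : V) (p : seq V) :
  verts G x -> path (edge G) x p -> {in x :: p, forall z, verts G z}.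
Proof.
elim: p x => [|y p IHp] x Gx /=; first by move=> _ z /[!inE] /eqP->.
move=> /andP[Gxy Gp] z /[!inE] /orP[/eqP->//|].
by apply: IHp Gp _; have [] := edge_verts Gxy.
Qed.

Lemma gdist_le (V : Type) (G : sgraph V) (x y : V) (k : nat) :
  walk G x y k -> (gdist G x y <= k)%N.
Proof. by move=> w; have [_] := gdistP (ex_intro _ k w); apply. Qed.

Lemma walk_gdist (V : Type) (G : sgraph V) (x y : V) :
  graph_connected G -> verts G x -> verts G y -> walk G x y (gdist G x y).
Proof. by move=> Gc Gx Gy; have [] := gdistP (Gc x y Gx Gy). Qed.

Lemma gdistxx (V : Type) (G : sgraph V) (x : V) : gdist G x x = 0%N.
Proof. by apply/eqP; rewrite -leqn0; apply/gdist_le/walk_refl. Qed.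

Lemma gdist_sym (V : Type) (G : sgraph V) (x y : V) (k : nat) :
  walk G x y k -> gdist G x y = gdist G y x.
Proof.
move=> w; have [wxy _] := gdistP (ex_intro _ k w).
have [wyx _] := gdistP (ex_intro _ k (walk_sym w)).
by apply/eqP; rewrite eqn_leq; apply/andP; split; apply/gdist_le/walk_sym.
Qed.

Lemma gdist_triangle (V : Type) (G : sgraph V) (x y z : V) :
  graph_connected G -> verts G x -> verts G y -> verts G z ->
  (gdist G x z <= gdist G x y + gdist G y z)%N.
Proof.
by move=> Gc Gx Gy Gz; apply/gdist_le/walk_cat; apply: walk_gdist.
Qed.

Lemma gdistC (V : Type) (G : sgraph V) (x y : V) :
  graph_connected G -> verts G x -> verts G y -> gdist G x y = gdist G y x.
Proof. by move=> Gc Gx Gy; apply: gdist_sym (walk_gdist Gc Gx Gy). Qed.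

Lemma ler_gdistD (R : realType) (V : Type) (G : sgraph V) (x y z : V) :
  graph_connected G -> verts G x -> verts G y -> verts G z ->
  (gdist G x z)%:R <= (gdist G x y)%:R + (gdist G y z)%:R :> R.
Proof.
by move=> Gc Gx Gy Gz; rewrite -natrD ler_nat; apply: gdist_triangle.
Qed.

Lemma gdist_subgraph (V : Type) (F G : sgraph V) (x y : V) :
  subgraph F G -> graph_connected F -> verts F x -> verts F y ->
  (gdist G x y <= gdist F x y)%N.
Proof.
by move=> FG Fc Fx Fy; apply/gdist_le/(walk_subgraph FG)/walk_gdist.
Qed.

(** A shortest walk, once its loops are removed, visits distinct vertices. *)
Lemma gdist_lt_size (V : eqType) (G : sgraph V) (s : seq V) (x y : V) :
  graph_connected G -> (forall z, verts G z -> z \in s) ->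
  verts G x -> verts G y -> (gdist G x y < size s)%N.
Proof.
move=> Gc Gs Gx Gy; have [p [Gp <- _]] := walk_gdist Gc Gx Gy.
case/shortenP: Gp => q Gq uq _.
have le_q : (gdist G x (last x q) <= size q)%N by apply: gdist_le; exists q.
apply: (leq_ltn_trans le_q).
by apply: (uniq_leq_size uq) => z /(path_verts Gx Gq) /Gs.
Qed.

(** Passing from the metric of [G] to that of [F] can only raise the right side
    of the four-point inequality, and raises the left side by at most
    [2 * c]. *)
Lemma hyperbolic_additive (R : realType) (V : Type) (delta c : R)
    (F G : sgraph V) :
  subgraph F G -> graph_connected F -> hyperbolic delta G ->
  (forall x y, verts F x -> verts F y ->
    (gdist F x y)%:R <= (gdist G x y)%:R + c) ->
  hyperbolic (delta + c) F.
Proof.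
move=> FG Fc hyp le_c w x y z Fw Fx Fy Fz /=.
have ge u v : verts F u -> verts F v ->
    (gdist G u v)%:R <= (gdist F u v)%:R :> R.
  by move=> Fu Fv; rewrite ler_nat; apply: gdist_subgraph.
have [VFG _] := FG.
have /= := hyp w x y z (VFG _ Fw) (VFG _ Fx) (VFG _ Fy) (VFG _ Fz).
have := (le_c x z Fx Fz, le_c y w Fy Fw).
have := (ge x y Fx Fy, ge z w Fz Fw, ge x w Fx Fw, ge z y Fz Fy).
by move=> [[[? ?] ?] ?] [? ?]; rewrite !maxEle; do 2 case: ifP => ?; lra.
Qed.

(** * Geodesics *)

Definition geodesic (V : Type) (G : sgraph V) (x : V) (p : seq V) : Prop :=
  path (edge G) x p /\ size p = gdist G x (last x p).

(** If one of the two halves could be shortened, so could the whole. *)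
Lemma geodesic_cat (V : Type) (G : sgraph V) (x : V) (p q : seq V) :
  geodesic G x (p ++ q) -> geodesic G x p /\ geodesic G (last x p) q.
Proof.
rewrite /geodesic cat_path last_cat size_cat => -[/andP[Gp Gq] sz].
have wp : walk G x (last x p) (size p) by exists p.
have wq : walk G (last x p) (last (last x p) q) (size q) by exists q.
have [wp' _] := gdistP (ex_intro _ _ wp).
have [wq' _] := gdistP (ex_intro _ _ wq).
have := gdist_le (walk_cat wp' wq').
have := (gdist_le wp, gdist_le wq); rewrite Gp Gq -sz => -[? ?] ?.
by split; split=> //; lia.
Qed.

Lemma geodesic_between (V : eqType) (G : sgraph V) (x z : V) (p : seq V) :
  geodesic G x p -> z \in x :: p ->
  (gdist G x z + gdist G z (last x p) = gdist G x (last x p))%N.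
Proof.
move=> + zp; case/splitPl: zp => p1 p2 <- Gp.
have [_ <-] := Gp; have [[_ <-]] := geodesic_cat Gp.
by rewrite last_cat size_cat => -[_ <-].
Qed.

Lemma geodesic_point (V : eqType) (G : sgraph V) (x : V) (p : seq V)
    (k : nat) :
  geodesic G x p -> (k <= size p)%N ->
  exists2 z, z \in x :: p & gdist G x z = k.
Proof.
move=> Gp kp; exists (last x (take k p)).
  have := mem_last x (take k p); rewrite !inE => /orP[->//|/mem_take ->].
  by rewrite orbT.
have [] : geodesic G x (take k p) /\ geodesic G (last x (take k p)) (drop k p).
  by apply: geodesic_cat; rewrite cat_take_drop.
by move=> [_ <-] _; rewrite size_takel.
Qed.

(** * Induced subgraphs *)

Lemma induced_sym (V : eqType) (G : sgraph V) (s : seq V) (x y : V) :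
  [&& edge G x y, x \in s & y \in s] -> [&& edge G y x, y \in s & x \in s].
Proof. by move=> /and3P[Gxy -> ->]; rewrite (edge_sym Gxy). Qed.

Lemma induced_irrefl (V : eqType) (G : sgraph V) (s : seq V) (x : V) :
  ~~ [&& edge G x x, x \in s & x \in s].
Proof. by rewrite (negbTE (edge_irrefl G x)). Qed.

Lemma induced_verts (V : eqType) (G : sgraph V) (s : seq V) (x y : V) :
  [&& edge G x y, x \in s & y \in s] -> [set` s] x /\ [set` s] y.
Proof. by move=> /and3P[]. Qed.

Definition induced (V : eqType) (G : sgraph V) (s : seq V) : sgraph V :=
  SGraph (@induced_sym V G s) (@induced_irrefl V G s) (@induced_verts V G s).

Lemma induced_subgraph (V : eqType) (G : sgraph V) (s : seq V) :
  {in s, forall z, verts G z} -> subgraph (induced G s) G.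
Proof. by move=> sG; split=> [z /sG//|x y /and3P[]]. Qed.

Lemma subgraph_induced (V : eqType) (H G : sgraph V) (s : seq V) :
  subgraph H G -> (forall z, verts H z -> z \in s) ->
  subgraph H (induced G s).
Proof.
move=> [_ HG] Hs; split=> [z /Hs//|x y Hxy] /=.
by have [/Hs-> /Hs->] := edge_verts Hxy; rewrite HG.
Qed.

Lemma walk_induced (V : eqType) (G : sgraph V) (s : seq V) (x : V)
    (p : seq V) :
  path (edge G) x p -> {subset x :: p <= s} ->
  walk (induced G s) x (last x p) (size p).
Proof.
move=> Gp ps; exists p; split=> //=.
elim: p x Gp ps => //= y p IHp x /andP[-> Gp] ps.
rewrite !ps ?inE ?eqxx ?orbT //= IHp // => z zp.
by rewrite ps // inE zp orbT.
Qed.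

(** A segment of a geodesic is geodesic, so a geodesic contained in [s] makes
    the induced subgraph isometric along itself. *)
Lemma geodesic_walk (V : eqType) (G : sgraph V) (s : seq V) (x u v : V)
    (p : seq V) :
  geodesic G x p -> {subset x :: p <= s} -> u \in x :: p -> v \in x :: p ->
  walk (induced G s) u v (gdist G u v).
Proof.
move=> + + up; case/splitPl: up => p1 p2 lastu.
move=> Gp ps; have [Gp1 Gp2] := geodesic_cat Gp.
rewrite -cat_cons mem_cat => /orP[].
  have {}ps : {subset x :: p1 <= s}.
    by move=> z zp; apply: ps; rewrite -cat_cons mem_cat zp.
  move: Gp1 ps lastu => + + + vp.
  case/splitPl: vp => q1 q2 lastv Gq ps; have [_ []] := geodesic_cat Gq.
  move: ps => {Gq}; rewrite last_cat lastv => ps Gq sq lastu.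
  rewrite lastu in sq.
  have wG : walk G v u (size q2) by exists q2.
  (* Here [v] comes before [u] on [p], so the segment is reversed. *)
  rewrite -(gdist_sym wG) -sq; apply: walk_sym; rewrite -lastu.
  apply: walk_induced => // z zp; apply: ps.
  move: zp; rewrite -cat_cons mem_cat inE => /orP[/eqP->|->].
    by rewrite -lastv mem_last.
  by rewrite orbT.
move=> vp2; have vp : v \in last x p1 :: p2 by rewrite inE vp2 orbT.
have {ps} : {subset last x p1 :: p2 <= s}.
  move=> z zp; apply: ps; move: zp.
  rewrite -cat_cons mem_cat inE => /orP[/eqP->|->]; last by rewrite orbT.
  by rewrite mem_last.
rewrite lastu in Gp2 vp * => ps {vp2}; move: Gp2 ps.
case/splitPl: vp => q1 q2 <- Gp2 ps; have [[Gq <-] _] := geodesic_cat Gp2.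
by apply: walk_induced => // z zp; rewrite ps // -cat_cons mem_cat zp.
Qed.

Definition geod (V : choiceType) (G : sgraph V) (x y : V) : seq V :=
  xget [::] [set p | geodesic G x p /\ last x p = y].

Lemma geodP (V : choiceType) (G : sgraph V) (x y : V) :
  graph_connected G -> verts G x -> verts G y ->
  geodesic G x (geod G x y) /\ last x (geod G x y) = y.
Proof.
move=> Gc Gx Gy; rewrite /geod; case: xgetP => [p _ []//|].
have [p [Gp lastp sp]] := walk_gdist Gc Gx Gy.
by move=> /(_ p) []; split=> //; split=> //; rewrite lastp.
Qed.

Lemma geod_walk (V : choiceType) (G : sgraph V) (s : seq V) (x y u v : V) :
  graph_connected G -> verts G x -> verts G y ->
  {subset x :: geod G x y <= s} ->
  u \in x :: geod G x y -> v \in x :: geod G x y ->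
  walk (induced G s) u v (gdist G u v).
Proof.
by move=> Gc Gx Gy; have [Gp _] := geodP Gc Gx Gy; exact: geodesic_walk.
Qed.

Lemma geod_between (V : choiceType) (G : sgraph V) (x y z : V) :
  graph_connected G -> verts G x -> verts G y -> z \in x :: geod G x y ->
  (gdist G x z + gdist G z y = gdist G x y)%N.
Proof.
move=> Gc Gx Gy; have [Gp yE] := geodP Gc Gx Gy.
by move=> zp; have := geodesic_between Gp zp; rewrite yE.
Qed.

(** * Linking nearby points by geodesics *)

(** Both steps of the construction are of this form: with [N] a bound on the
    diameter of [s] it gives a hull that is roughly convex, and with [N] of the
    order of [delta] it only adds short bridges. *)
Definition links (V : choiceType) (G : sgraph V) (N : nat) (s : seq V) :
    seq V :=
  flatten [seq if (gdist G x y <= N)%N then x :: geod G x y else [::]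
          | x <- s, y <- s].

Lemma linksP (V : choiceType) (G : sgraph V) (N : nat) (s : seq V) (z : V) :
  reflect (exists x y, [/\ x \in s, y \in s, (gdist G x y <= N)%N
                         & z \in x :: geod G x y])
          (z \in links G N s).
Proof.
apply: (iffP flattenP) => [[_ /allpairsP[[x y] /= [xs ys ->]]]|].
  by case: ifP => // Nxy zp; exists x, y.
move=> [x [y [xs ys Nxy zp]]]; exists (x :: geod G x y) => //.
by apply/allpairsP; exists (x, y) => /=; rewrite Nxy.
Qed.

Lemma mem_links (V : choiceType) (G : sgraph V) (N : nat) (s : seq V) :
  {subset s <= links G N s}.
Proof.
move=> x xs; apply/linksP; exists x, x.
by rewrite gdistxx xs mem_head.
Qed.

Lemma links_geod (V : choiceType) (G : sgraph V) (N : nat) (s : seq V)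
    (x y : V) :
  x \in s -> y \in s -> (gdist G x y <= N)%N ->
  {subset x :: geod G x y <= links G N s}.
Proof. by move=> xs ys Nxy z zp; apply/linksP; exists x, y. Qed.

Lemma links_verts (V : choiceType) (G : sgraph V) (N : nat) (s : seq V) :
  graph_connected G -> {in s, forall z, verts G z} ->
  {in links G N s, forall z, verts G z}.
Proof.
move=> Gc sG z /linksP[x [y [/sG Gx /sG Gy _]]].
by have [[Gp _] _] := geodP Gc Gx Gy; apply: path_verts.
Qed.

Lemma size_links (V : choiceType) (G : sgraph V) (N : nat) (s : seq V) :
  (size (links G N s) <= size s ^ 2 * N.+1)%N.
Proof.
rewrite size_flatten.
have bound (t : seq (seq V)) : all (fun p => size p <= N.+1)%N t ->
    (sumn (shape t) <= size t * N.+1)%N.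
  by elim: t => //= p t IHt /andP[pN /IHt]; rewrite mulSn; apply: leq_add.
have -> : (size s ^ 2)%N =
    size [seq if (gdist G x y <= N)%N then x :: geod G x y else [::]
         | x <- s, y <- s] by rewrite size_allpairs.
apply/bound/allP => _ /allpairsP[[x y] /= [_ _ ->]]; case: ifP => //=.
rewrite /geod; case: xgetP => [p _ [[_ ->] ->]|_] //.
Qed.

(** * Thin quadrilaterals *)

(** Take [z] on the geodesic at distance [gdist G a x] from [a] and apply the
    four-point inequality to the pairs [(x, z)] and [(a, c)]. *)
Lemma geod_near (R : realType) (V : choiceType) (delta : R) (G : sgraph V)
    (a c x : V) :
  0 <= delta -> graph_connected G -> hyperbolic delta G ->
  verts G a -> verts G c -> verts G x ->
  (gdist G a x)%:R + (gdist G x c)%:R <= (gdist G a c)%:R + 6 * delta :> R ->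
  exists2 z, z \in a :: geod G a c & (gdist G x z)%:R <= 8 * delta.
Proof.
move=> d0 Gc hyp Ga Gcc Gx axc; have [Gp lastp] := geodP Gc Ga Gcc.
have sp : size (geod G a c) = gdist G a c by have [_ ->] := Gp; rewrite lastp.
have [le|lt] := leqP (gdist G a x) (gdist G a c); last first.
  (* No such [z] exists: [x] is beyond [c], and at most [6 * delta] away. *)
  exists c; first by rewrite -{1}lastp mem_last.
  by move: lt; rewrite -(ltr_nat R) => lt; lra.
have [|z zp az] := geodesic_point Gp (k := gdist G a x); first by rewrite sp.
exists z => //.
have azc := geod_between Gc Ga Gcc zp.
have Gz : verts G z by have [Gp' _] := Gp; exact: path_verts zp.
have /= := hyp c x a z Gcc Gx Ga Gz.
have sym := gdistC Gc.
rewrite -(sym a x) // -(sym a z) // az.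
have : (gdist G a z)%:R + (gdist G z c)%:R = (gdist G a c)%:R :> R.
  by rewrite -natrD azc.
rewrite az !maxEle => ?; case: ifP => _ ?; lra.
Qed.

(** In a tree, a point of [[a, b]] separates any [y] from [a] or from [b]; this
    is the coarse version. *)
Lemma geod_end (R : realType) (V : choiceType) (delta : R) (G : sgraph V)
    (a b x y : V) :
  graph_connected G -> hyperbolic delta G ->
  verts G a -> verts G b -> verts G y -> x \in a :: geod G a b ->
  exists2 e, e \in [:: a; b] &
    (gdist G e x)%:R + (gdist G x y)%:R <= (gdist G e y)%:R + 2 * delta :> R.
Proof.
move=> Gc hyp Ga Gb Gy xp.
have [[Gp _] _] := geodP Gc Ga Gb; have Gx := path_verts Ga Gp xp.
have sym := gdistC Gc.
have : (gdist G a x)%:R + (gdist G x b)%:R = (gdist G a b)%:R :> R.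
  by rewrite -natrD (geod_between Gc).
have /= := hyp b x a y Gb Gx Ga Gy.
rewrite (sym x a) // (sym y b) // (sym x b) // (sym y a) // maxEle.
case: ifP => _ ? ?.
  by exists a; rewrite ?mem_head //; lra.
by exists b; rewrite ?inE ?eqxx ?orbT //; lra.
Qed.

(** The end [u] is chosen to make [u], [x], [y] nearly aligned, and [v] to make
    [x], [y], [v] nearly aligned.  These alignments combine into a single one
    as soon as [x] and [y] are not too close: in the four-point inequality for
    [(u, y)] and [(x, v)], the pairing [(u, x)], [(v, y)] would be the larger
    one only if [2 * gdist G x y <= 6 * delta]. *)
Lemma geod_pair (R : realType) (V : choiceType) (delta : R) (G : sgraph V)
    (a b c e x y : V) :
  graph_connected G -> hyperbolic delta G ->
  verts G a -> verts G b -> verts G c -> verts G e ->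
  x \in a :: geod G a b -> y \in c :: geod G c e ->
  (gdist G x y)%:R <= 3 * delta \/
  exists u v, [/\ u \in [:: a; b], v \in [:: c; e] &
    (gdist G u x)%:R + (gdist G x y)%:R + (gdist G y v)%:R
      <= (gdist G u v)%:R + 6 * delta :> R].
Proof.
move=> Gc hyp Ga Gb Gcc Ge xp yp.
have [[Gp _] _] := geodP Gc Ga Gb; have Gx := path_verts Ga Gp xp.
have [[Gq _] _] := geodP Gc Gcc Ge; have Gy := path_verts Gcc Gq yp.
have [u uab le_u] := geod_end Gc hyp Ga Gb Gy xp.
have [v vce le_v] := geod_end Gc hyp Gcc Ge Gx yp.
have Gu : verts G u by move: uab; rewrite !inE => /orP[]/eqP->.
have Gv : verts G v by move: vce; rewrite !inE => /orP[]/eqP->.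
have sym := gdistC Gc.
have /= := hyp v u x y Gv Gu Gx Gy.
move: le_v; rewrite (sym v y) // (sym y x) // (sym v x) //.
rewrite maxEle => le_v; case: ifP => _ le; last by left; lra.
by right; exists u, v; split=> //; lra.
Qed.

(** * The linked hull *)

(** With [x'] and [y'] the points of [[u, v]] given by [geod_near], the route
    through [x'] and [y'] costs [8 * delta] at each end, and by the triangle
    inequality [gdist G x' y'] exceeds [gdist G x y] by at most
    [16 * delta]. *)
Lemma hull_walk (R : realType) (V : choiceType) (delta : R) (G : sgraph V)
    (N : nat) (s : seq V) (x y : V) :
  0 <= delta -> graph_connected G -> hyperbolic delta G ->
  {in s, forall z, verts G z} -> {in s &, forall a b, (gdist G a b <= N)%N} ->
  let X := links G N s in
  x \in X -> y \in X ->
  exists2 k, walk (induced G (links G (Num.truncn (8 * delta)) X)) x y k &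
    k%:R <= (gdist G x y)%:R + 32 * delta.
Proof.
move=> d0 Gc hyp sG sN X xX yX; set M := Num.truncn _.
have XG : {in X, forall z, verts G z} by apply: links_verts.
have jump u v : u \in X -> v \in X -> (gdist G u v)%:R <= 8 * delta ->
    walk (induced G (links G M X)) u v (gdist G u v).
  move=> uX vX uv; have Gu := XG u uX; have Gv := XG v vX.
  have [_ lastv] := geodP Gc Gu Gv.
  apply: (geod_walk Gc Gu Gv); rewrite ?mem_head //; last first.
    by rewrite -{1}lastv mem_last.
  by apply: links_geod => //; rewrite truncn_ge_nat //; lra.
have Gx := XG x xX; have Gy := XG y yX.
have /linksP[a [b [sa sb _ xab]]] := xX.
have /linksP[c [e [sc se _ yce]]] := yX.
have [near|[u [v [uab vce le_uv]]]] :=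
  geod_pair Gc hyp (sG _ sa) (sG _ sb) (sG _ sc) (sG _ se) xab yce.
  by exists (gdist G x y); [apply: jump => //; lra|lra].
have su : u \in s by move: uab; rewrite !inE => /orP[]/eqP->.
have sv : v \in s by move: vce; rewrite !inE => /orP[]/eqP->.
have [Gu Gv] := (sG u su, sG v sv).
have tri p q r := @ler_gdistD R V G p q r Gc.
have sym := gdistC Gc.
have uvX : {subset u :: geod G u v <= X} by apply: links_geod; auto.
have [|x' x'uv xx'] := geod_near d0 Gc hyp Gu Gv Gx.
  by have := tri x y v Gx Gy Gv; lra.
have [|y' y'uv yy'] := geod_near d0 Gc hyp Gu Gv Gy.
  by have := tri u x y Gu Gx Gy; lra.
have [x'X y'X] := (uvX x' x'uv, uvX y' y'uv).
have [Gx' Gy'] := (XG x' x'X, XG y' y'X).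
exists (gdist G x x' + (gdist G x' y' + gdist G y' y))%N.
  apply: walk_cat (jump _ _ xX x'X xx') _; apply: walk_cat (jump _ _ y'X yX _).
    by apply: (geod_walk Gc Gu Gv) => // z /uvX; apply: mem_links.
  by rewrite (sym y' y).
have := (tri x' x y' Gx' Gx Gy', tri x y y' Gx Gy Gy').
rewrite !natrD (sym x' x) // (sym y' y) // => -[? ?]; lra.
Qed.

(** Each end of the walk is first moved to the hull along the bridge that
    contains it, at cost at most [8 * delta]; the move enters once in the
    length of the walk and once in the distance between its ends. *)
Lemma linked_hull_walk (R : realType) (V : choiceType) (delta : R)
    (G : sgraph V) (N : nat) (s : seq V) (x y : V) :
  0 <= delta -> graph_connected G -> hyperbolic delta G ->
  {in s, forall z, verts G z} -> {in s &, forall a b, (gdist G a b <= N)%N} ->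
  let L := links G (Num.truncn (8 * delta)) (links G N s) in
  x \in L -> y \in L ->
  exists2 k, walk (induced G L) x y k &
    k%:R <= (gdist G x y)%:R + 64 * delta.
Proof.
move=> d0 Gc hyp sG sN; set X := links G N s; set M := Num.truncn _ => L.
have XG : {in X, forall z, verts G z} by apply: links_verts.
have LG : {in L, forall z, verts G z} by apply: links_verts.
have anchor z : z \in L -> exists z', [/\ z' \in X,
    walk (induced G L) z z' (gdist G z z') & (gdist G z z')%:R <= 8 * delta].
  move=> zL; have /linksP[p [q [pX qX pqM zpq]]] := zL.
  have [[Gp Gq] Gz] := (XG p pX, XG q qX, LG z zL).
  exists p; split=> //.
    by apply: (geod_walk Gc Gp Gq) => //; [apply: links_geod|rewrite mem_head].
  have := geod_between Gc Gp Gq zpq; rewrite -(gdistC Gc Gp Gz).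
  move=> pzq; rewrite -truncn_ge_nat; last by lra.
  by apply: leq_trans pqM; rewrite -pzq leq_addr.
move=> xL yL; have [x' [x'X xx' dxx']] := anchor x xL.
have [y' [y'X yy' dyy']] := anchor y yL.
have [k wk le_k] := hull_walk d0 Gc hyp sG sN x'X y'X.
exists (gdist G x x' + (k + gdist G y y'))%N.
  by apply: walk_cat xx' (walk_cat wk (walk_sym yy')).
have [Gx Gy] := (LG x xL, LG y yL); have [Gx' Gy'] := (XG x' x'X, XG y' y'X).
have tri p q r := @ler_gdistD R V G p q r Gc.
have := (tri x' x y' Gx' Gx Gy', tri x y y' Gx Gy Gy').
rewrite !natrD (gdistC Gc Gx' Gx) => -[? ?]; lra.
Qed.

(** The choice structure on the vertices serves to select geodesics; an
    arbitrary type acquires one classically. *)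
Lemma exists_hyperbolic_subgraph (R : realType) (delta : R) (V : choiceType)
    (G H : sgraph V) (n : nat) :
  0 <= delta -> graph_connected G -> hyperbolic delta G ->
  subgraph H G -> graph_connected H -> verts H #= `I_n -> (0 < n)%N ->
  exists F : sgraph V,
    [/\ subgraph F G, graph_connected F, subgraph H F,
        exists2 m : nat, verts F #= `I_m &
          m%:R <= (8 * delta + 1) * n%:R ^+ 6
      & hyperbolic (delta + 64 * delta) F].
Proof.
move=> d0 Gc hyp HG Hc Hn n0; have Hfin : finite_set (verts H).
  by apply/finite_setP; exists n.
pose s : seq V := fset_set (verts H).
have Hs z : z \in s <-> verts H z.
  by rewrite /s in_fset_set // inE.
have size_s : size s = n by apply: card_fset_set.
have sG : {in s, forall z, verts G z} by move=> z /Hs; apply: HG.1.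
have sN : {in s &, forall a b, (gdist G a b <= n.-1)%N}.
  move=> a b /Hs Ha /Hs Hb; rewrite -ltnS prednK // -size_s.
  apply: leq_ltn_trans (gdist_subgraph HG Hc Ha Hb) _.
  by apply: gdist_lt_size => // z /Hs.
pose X := links G n.-1 s; pose M := Num.truncn (8 * delta).
pose L := links G M X.
have LG : {in L, forall z, verts G z} by do 2 apply: links_verts => //.
have lhw x y := @linked_hull_walk R V delta G n.-1 s x y d0 Gc hyp sG sN.
have FG := induced_subgraph LG.
have Fc : graph_connected (induced G L).
  by move=> x y xL yL; have [k wk _] := lhw x y xL yL; exists k.
exists (induced G L); split=> //.
- by apply: subgraph_induced => // z /Hs zs; do 2 apply: mem_links.
- exists #|`[fset z in L]%fset|.
    have -> : verts (induced G L) = [set` [fset z in L]%fset].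
      by apply/seteqP; split=> z /=; rewrite inE.
    exact/card_eq_fsetP.
  rewrite card_fseq; have : (size (undup L) <= n ^ 6 * M.+1)%N.
    apply: leq_trans (size_undup _) (leq_trans (size_links _ _ _) _).
    rewrite leq_mul2r /= -[6%N]/(3 * 2)%N expnM leq_sqr.
    by rewrite (leq_trans (size_links _ _ _)) // size_s prednK // -expnSr.
  rewrite -(ler_nat R) natrM natrX => /le_trans; apply.
  rewrite mulrC ler_wpM2r ?exprn_ge0 // -natr1 lerD2r.
  by rewrite truncn_le; lra.
- apply: hyperbolic_additive Fc hyp _ => // x y xL yL.
  have [k wk le_k] := lhw x y xL yL; apply: le_trans le_k.
  by rewrite ler_nat; apply: gdist_le.
Qed.

Theorem proposition4p2 (R : realType) (delta : R) (delta_ge0 : 0 <= delta) :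
  exists2 Delta : R, 0 <= Delta &
  forall (V : Type) (G H : sgraph V) (n : nat),
    graph_connected G -> hyperbolic delta G ->
    subgraph H G -> graph_connected H -> verts H #= `I_n -> (2 <= n)%N ->
  exists F : sgraph V,
    [/\ subgraph F G, graph_connected F, subgraph H F,
        exists2 m : nat, verts F #= `I_m &
          m%:R <= (16 * delta + 3) * n%:R ^+ 6
      & hyperbolic Delta F].
Proof.
exists (delta + 64 * delta); first by lra.
move=> V G H n Gc hyp HG Hc Hn n2.
have [F [FG Fc HF [m Fm le_m] hypF]] :=
  @exists_hyperbolic_subgraph R delta {classic V} G H n
    delta_ge0 Gc hyp HG Hc Hn (ltnW n2).
exists F; split=> //; exists m => //; apply: le_trans le_m _.
by apply: ler_wpM2r; [apply: exprn_ge0|lra].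
Qed.
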